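(* Let $\theta>0$ and, for $x>0$, let $X(t)=x-N_t$, where $N_t$ is a homogeneous Poisson process with intensity $\theta$ and $N_0=0$. Let $\tau(x)=\inf\{t>0: X(t)\le 0\}$ and $A(x)=\int_0^{\tau(x)}X(t)\,dt$. Then $$E[\tau(x)A(x)]=\begin{cases}\dfrac{x(x+1)^2}{2\theta^2} & \text{if } x \text{ is a positive integer},\\[2mm] \dfrac{([x]+1)([x]+2)(2x-[x])}{2\theta^2} & \text{if } x>0 \text{ is not an integer}.\end{cases}$$
   Context: $[x]$ denotes the integer part of $x$. *)

(* Defs.v *)
From HB Require Import structures.
From mathcomp Require Import all_boot all_order all_algebra.
From mathcomp Require Import all_classical all_reals all_analysis.

Set Implicit Arguments.
Unset Strict Implicit.
Unset Printing Implicit Defensive.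

Import Order.TTheory GRing.Theory Num.Theory.
Import numFieldNormedType.Exports.

Local Open Scope classical_set_scope.
Local Open Scope ring_scope.

Definition mutually_independent (d d' : measure_display) (T : measurableType d)
    (T' : measurableType d') (R : realType) (P : probability T R) (I : finType)
    (X : I -> T -> T') : Prop :=
  forall (J : {set I}) (B : I -> set T'), (forall i, measurable (B i)) ->
    P (\bigcap_(i in [set` J]) (X i @^-1` B i)) =
    (\prod_(i in J) P (X i @^-1` B i))%E.

(* The subtraction is truncated; it is the true increment for s <= t, since
   the paths of a Poisson process are nondecreasing. *)
Definition increment (T R : Type) (N : R -> T -> nat) (s t : R) (w : T) : nat :=
  (N t w - N s w)%N.

(* Time is indexed by all of R, but only the variables N t with 0 <= t are
   constrained; poisson_pmf r k = r ^ k / k! * exp (- r) for r > 0. *)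
Record poisson_process (d : measure_display) (T : measurableType d)
    (R : realType) (P : probability T R) (theta : R)
    (N : R -> {RV P >-> nat}) : Prop := PoissonProcess {
  poisson_process_start : forall w, N 0 w = 0%N ;
  poisson_process_nondecreasing : forall w s t,
    0 <= s -> s <= t -> (N s w <= N t w)%N ;
  poisson_process_right_continuous : forall w t, 0 <= t ->
    ((N u w)%:R : R) @[u --> t^'+] --> ((N t w)%:R : R) ;
  poisson_process_independent_increments : forall (n : nat) (t : nat -> R),
    0 <= t 0%N -> (forall i, (i < n)%N -> t i < t i.+1) ->
    mutually_independent P (fun i : 'I_n => increment N (t i) (t i.+1)) ;
  poisson_process_increment_law : forall (s t : R) (k : nat),
    0 <= s -> s < t ->
    P (increment N s t @^-1` [set k]) = (poisson_pmf (theta * (t - s)) k)%:E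
}.

Arguments poisson_process {d T R} P theta N.

Section first_passage.
Context {T : Type} {R : realType}.
Variables (x : R) (N : R -> T -> nat).

Definition level (t : R) (w : T) : R := x - (N t w)%:R.

(* The infimum is +oo when the path never reaches ]-oo, 0]. *)
Definition passage_time (w : T) : \bar R :=
  ereal_inf [set t%:E | t in [set t : R | 0 < t /\ level t w <= 0]].

Definition passage_area (w : T) : \bar R :=
  (\int[lebesgue_measure]_(t in [set t : R | (0 <= t)%R /\ t%:E <= passage_time w])
     (level t w)%:E)%E.

End first_passage.

(* Main.v *)
Require Import Defs.
From HB Require Import structures.
From mathcomp Require Import all_boot all_order all_algebra.
From mathcomp Require Import all_classical all_reals all_analysis.
From mathcomp Require Import measurable_realfun ring lra.

(* Let tau_k be the first time at which N reaches k, and n the least integer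
   with x <= n, so that tau(x) = tau_n.  Before tau_n the path of X is
     x - N_t = (x - n + 1) + #{k : 1 <= k < n, N_t < k},
   hence A(x) = (x - n + 1) tau_n + sum_(1 <= k < n) tau_k, with nonnegative
   coefficients.  By Tonelli,
     E[tau_n tau_k] = \int\int P(N_s < n, N_t < k) ds dt,
   and for k <= n the independence of increments turns the inner integral into
     sum_(j < k) P(N_t = j) (t + (n - j) / theta),
   because each \int P(N_u = i) du equals 1 / theta.  As
   t P(N_t = j) = (j + 1) / theta * P(N_t = j + 1), the outer integral is
   k (n + 1) / theta^2, and E[tau(x) A(x)] follows by summation over k. *)

Set Implicit Arguments.
Unset Strict Implicit.
Unset Printing Implicit Defensive.

Import Order.TTheory GRing.Theory Num.Theory.
Import numFieldNormedType.Exports.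

Local Open Scope classical_set_scope.
Local Open Scope ring_scope.

(** * Time integrals of Poisson probabilities *)

Section poisson_integral.
Context {R : realType}.
Implicit Types (y a t : R) (k : nat).

(** Squeeze between 0 and [C / y]: since exp(y) = exp(y / (k+1))^(k+1) and exp(z) >= z, exp(y)
    dominates y^(k+1) / (k+1)^(k+1), which is where [C] comes from. *)
Lemma cvgr_exprn_expRN k : y ^+ k * expR (- y) @[y --> +oo%R] --> (0 : R).
Proof.
pose C : R := k.+1%:R ^+ k.+1.
apply: (@squeeze_cvgr _ _ _ _ (cst 0) (fun y => C * y^-1)).
- near=> y.
  have y0 : 0 < y by near: y; exact: nbhs_pinfty_gt.
  apply/andP; split; first by rewrite mulr_ge0 ?exprn_ge0 ?expR_ge0// ltW.
  rewrite expRN /= ler_pdivlMr// mulrAC -exprSr ler_pdivrMr ?expR_gt0//.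
  have k0 : (0 : R) < k.+1%:R by rewrite ltr0n.
  rewrite /C -ler_pdivrMl ?exprn_gt0//.
  have -> : (k.+1%:R ^+ k.+1)^-1 * y ^+ k.+1 = (y / k.+1%:R) ^+ k.+1 :> R.
    by rewrite mulrC -exprVn -exprMn.
  have -> : expR y = expR (y / k.+1%:R) ^+ k.+1.
    by rewrite -expRM_natl mulrC divfK// gt_eqF.
  rewrite lerXn2r ?nnegrE ?expR_ge0 ?divr_ge0 ?ltW//.
  by apply: lt_le_trans (expR_ge1Dx _); rewrite ltrDr.
- exact: cvg_cst.
- rewrite -[X in _ --> X](mulr0 C); apply: cvgMr.
  by apply/gtr0_cvgV0; [exact: nbhs_pinfty_gt|exact: cvg_id].
Unshelve. all: by end_near. Qed.

(** Agrees with [poisson_pmf y k] for y > 0, but is smooth on all of R, including at 0. *)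
Let q k y : R := y ^+ k * k`!%:R^-1 * expR (- y).

(** The probability that a Poisson variable of parameter y is at most k, seen as a function of y. *)
Let Q k y : R := \sum_(l < k.+1) q l y.

(** The sum telescopes, because q_(l+1)' = q_l - q_(l+1) and q_0' = - q_0. *)
Let is_derive_Q k y : is_derive y 1 (Q k) (- q k y).
Proof.
elim: k y => [|k ih] y.
  have -> : Q 0 = fun y => expR (- y).
    by apply/funext => z; rewrite /Q big_ord1 /q expr0 fact0 invr1 !mul1r.
  rewrite /q expr0 fact0 invr1 !mul1r.
  by apply: is_derive_eq; rewrite /GRing.scale/=; ring.
have -> : Q k.+1 = Q k \+ (q k.+1).
  by apply/funext => z; rewrite /Q big_ord_recr.
have f0 : k.+1%:R != 0 :> R by rewrite pnatr_eq0.
have f1 : k`!%:R != 0 :> R by rewrite pnatr_eq0 -lt0n fact_gt0.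
have qE : q k.+1 =
    (k.+1`!%:R^-1 \*: (id ^+ k.+1 : R -> R)) * (expR \o (-%R : R -> R)).
  by apply/funext => z; rewrite /q [_ * _^-1]mulrC /= !fctE.
have dq : is_derive y 1 (q k.+1) (q k y - q k.+1 y).
  rewrite [X in is_derive _ _ X]qE; apply: is_derive_eq.
  rewrite /q factS natrM /GRing.scale/= exprfctE exprS /GRing.scale/=.
  by field; rewrite f1 addrC natr1.
by apply: is_derive_eq; rewrite addrA addNr add0r.
Qed.

Let cvg_q k : q k y @[y --> +oo%R] --> 0.
Proof.
rewrite -[X in _ --> X](mulr0 (k`!%:R^-1 : R)).
rewrite [q k](_ : _ = fun y => k`!%:R^-1 * (y ^+ k * expR (- y))); last first.
  by apply/funext => y; rewrite /q mulrCA mulrA.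
exact: cvgMr (cvgr_exprn_expRN k).
Qed.

Let cvg_Q k : Q k y @[y --> +oo%R] --> 0.
Proof.
elim: k => [|k ih].
  by rewrite [Q 0](_ : _ = q 0)//; apply/funext => z; rewrite /Q big_ord1.
rewrite [Q k.+1](_ : _ = Q k \+ q k.+1); last first.
  by apply/funext => z; rewrite /Q big_ord_recr.
by rewrite -[X in _ --> X](addr0 0); exact: cvgD.
Qed.

(** The antiderivative - Q_k(theta (t - a)) / theta rises from - 1 / theta at [a] to 0 at infinity,
    whatever k is. *)
Lemma integral_poisson_pmf theta a k : 0 < theta ->
  (\int[lebesgue_measure]_(t in `]a, +oo[)
     (poisson_pmf (theta * (t - a)) k)%:E)%E = (theta^-1)%:E.
Proof.
move=> theta0.
pose l t := theta * (t - a).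
pose f := q k \o l; pose F := - theta^-1 \*: (Q k \o l).
have dl t : is_derive t 1 l theta.
  by apply: is_derive_eq; rewrite /GRing.scale/= oppr0 addr0 mulr1.
have dF t : is_derive t 1 F (f t).
  have dQ := is_derive_Q k (l t).
  apply: is_derive_eq.
  by rewrite /GRing.scale/= /f/=; field; rewrite gt_eqF.
have cf : continuous f.
  move=> t; apply: continuous_comp.
    by apply: differentiable_continuous; apply/derivable1_diffP; case: (dl t).
  rewrite /q.
  apply: cvgM; last first.
    by apply: (@continuous_comp _ _ _ -%R expR);
      [exact: oppr_continuous|exact: continuous_expR].
  by apply: cvgMl; exact: exprn_continuous.
(* The open end at [a] matters here: [poisson_pmf] and [q] agree only at positive parameters. Once
   the integrand is the continuous [f], the end point can be added for the fundamental theorem of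
   calculus. *)
transitivity (\int[lebesgue_measure]_(t in `]a, +oo[) (f t)%:E)%E.
  apply: eq_integral => t; rewrite inE/= in_itv/= andbT => at_.
  by rewrite /poisson_pmf mulr_gt0 ?subr_gt0.
rewrite integral_itv_obnd_cbnd; last first.
  apply/measurable_EFinP; apply: measurable_funTS.
  exact: measurable_realfun.continuous_measurable_fun.
rewrite (@ge0_continuous_FTC2y _ f F a 0).
- rewrite -EFinB /F /= /l subrr mulr0 /Q big_ord_recl big1 ?addr0.
    rewrite /q expr0 fact0 oppr0 expR0 invr1 !mulr1 /GRing.scale/=.
    by rewrite mulr1 opprK add0r.
  by move=> i _; rewrite /q expr0n mul0r mul0r.
- move=> t at_; rewrite /f/= /q mulr_ge0 ?expR_ge0// divr_ge0// exprn_ge0//.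
  by rewrite mulr_ge0 ?subr_ge0// ltW.
- exact: continuous_subspaceT.
- rewrite -[X in _ --> X](mulr0 (- theta^-1)); apply: cvgMr.
  apply: cvg_comp (cvg_Q k).
  by apply: gt0_cvgMry => //; exact: cvg_addrr.
- by move=> t _; case: (dF t).
- apply: cvg_at_right_filter.
  by apply: differentiable_continuous; apply/derivable1_diffP; case: (dF a).
- by move=> t _; rewrite derive1E; case: (dF t).
Qed.

End poisson_integral.

(** * Arrival times of the process *)

(** Used with an arrival time for [e], to recover it as the length of the set of earlier times; the
    value [+oo] has to be covered. *)
Lemma lebesgue_measure_lt_ereal (R : realType) (e : \bar R) : (0 <= e)%E ->
  lebesgue_measure [set t : R | 0 < t /\ (t%:E < e)%E] = e.
Proof.
case: e => [r r0|_|//].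
- rewrite [X in lebesgue_measure X](_ : _ = `]0, r[%classic); last first.
    by apply/seteqP; split=> t /=; rewrite in_itv/= lte_fin => /andP.
  rewrite lebesgue_measure_itv/= lte_fin oppr0 adde0.
  by move: r0; rewrite lee_fin le_eqVlt => /predU1P[<-|->//]; rewrite ltxx.
- rewrite [X in lebesgue_measure X](_ : _ = `]0, +oo[%classic).
    by rewrite lebesgue_measure_itv/= ltry oppr0 addye.
  by apply/seteqP; split=> t /=; rewrite in_itv/= andbT ltry => // -[].
Qed.

(** Shaped like [passage_time], with values in the extended reals: it is [+oo] on a path that never
    reaches k. *)
Definition arrival_time (T : Type) (R : realType) (N : R -> T -> nat) (k : nat)
    (w : T) : \bar R :=
  ereal_inf [set t%:E | t in [set t : R | 0 < t /\ (k <= N t w)%N]].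

(* Time 0 is left out because poisson_pmf 0 k is the junk value 1. *)
Definition unarrived (T : Type) (R : realType) (N : R -> T -> nat) (k : nat) :
    set (T * R) :=
  [set p | 0 < p.2 /\ (N p.2 p.1 < k)%N].

Section arrival.
Context {d : measure_display} {T : measurableType d} {R : realType}.
Context {P : probability T R} {theta : R} {N : R -> {RV P >-> nat}}.
Hypothesis poissonN : poisson_process P theta N.

Local Notation tau := (arrival_time N).
Local Notation mu := (@lebesgue_measure R).

Lemma arrival_time_ge0 k w : (0 <= tau k w)%E.
Proof.
by apply: le_ereal_inf_tmp => _ /= [t [t0 _] <-]; rewrite lee_fin ltW.
Qed.

(** If k <= N_t, then t > 0 because N_0 = 0 < k, so t bounds the infimum from above. If N_t < k,
    right continuity keeps the count below k for a further time [e], so the infimum is at least t +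
    e. *)
Lemma lt_arrival_time k w t : (0 < k)%N -> 0 <= t ->
  (t%:E < tau k w)%E = (N t w < k)%N.
Proof.
move=> k0 t0; apply/idP/idP => [|Ntk].
  apply: contraTT; rewrite -leqNgt -leNgt => kN; apply: ereal_inf_lbound.
  exists t => //=; split=> //; rewrite lt_neqAle t0 andbT; apply/eqP => t0E.
  by move: kN; rewrite -t0E (poisson_process_start poissonN) leqNgt k0.
have /cvgrPdist_lt /(_ 1 ltr01) Nr :=
  poisson_process_right_continuous poissonN (w := w) t0.
(* Counts are integers: one that is at least N_t and within distance less than 1 of it equals
   N_t. *)
have [e /= e0 He] : exists2 e : R, 0 < e &
    forall u, t < u -> u < t + e -> N u w = N t w.
  case: Nr => e /= e0 He; exists e => // u tu ute.
  have := He u; rewrite /ball_/= ltr0_norm ?subr_lt0// opprB.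
  rewrite ltrBlDl => /(_ ute tu).
  rewrite ltr_norml => /andP[h1 h2].
  have tuN := @poisson_process_nondecreasing _ _ _ _ _ _ poissonN w _ _
    t0 (ltW tu).
  apply/eqP; rewrite eqn_leq tuN andbT -ltnS.
  by rewrite -(ltr_nat R) -natr1; lra.
apply: (@lt_le_trans _ _ (t + e)%:E); first by rewrite lte_fin ltrDl.
apply: le_ereal_inf_tmp => _ /= [u [u0 kNu] <-]; rewrite lee_fin leNgt.
apply/negP => ute; have [ut|tu] := leP u t.
  have := @poisson_process_nondecreasing _ _ _ _ _ _ poissonN w _ _ (ltW u0) ut.
  by rewrite leqNgt (leq_trans Ntk kNu).
by move: kNu; rewrite (He u tu ute) leqNgt Ntk.
Qed.

Lemma measurable_arrival_time k : (0 < k)%N -> measurable_fun setT (tau k).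
Proof.
move=> k0; apply: (measurability _ (ErealGenOInfty.measurableE R)).
move=> _ [_ [r ->] <-]; rewrite setTI.
have [r0|r0] := leP 0 r; last first.
  rewrite [X in measurable X](_ : _ = setT)//; apply/seteqP; split=> // w _ /=.
  by rewrite in_itv/= andbT (lt_le_trans _ (arrival_time_ge0 k w))// lte_fin.
rewrite [X in measurable X](_ : _ = N r @^-1` [set m | (m < k)%N]).
  by rewrite -[X in measurable X]setTI; exact: measurable_funP.
by apply/seteqP; split=> w /=; rewrite in_itv/= andbT lt_arrival_time.
Qed.

(** The joint measurability required by Tonelli: among positive times, the set is the region
    strictly below the graph of [tau k]. *)
Lemma measurable_unarrived k : (0 < k)%N ->
  measurable (unarrived N k : set (T * measurableTypeR R)).
Proof.
move=> k0.
pose f (p : T * measurableTypeR R) : \bar R := p.2%:E.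
pose D := [set: T] `*` [set` `]0, +oo[ : interval R].
have mD : measurable (D : set (T * measurableTypeR R)).
  by apply: measurableX.
rewrite [X in measurable X](_ : _ = D `&` [set p | (f p < tau k p.1)%E]).
  apply: measurable_lte => //.
    by apply/measurable_EFinP; apply: measurable_funTS.
  apply: measurable_funTS; apply: measurableT_comp => //.
  exact: measurable_arrival_time.
apply/seteqP; split=> -[w t] /=; rewrite /D/= in_itv/= andbT.
  by move=> [t0 Nk]; rewrite lt_arrival_time ?ltW.
by move=> [[_ t0]]; rewrite lt_arrival_time ?ltW.
Qed.

(** The section of the set at [w] consists of the times strictly between 0 and [tau k w]. *)
Lemma integral_unarrived k w : (0 < k)%N ->
  (\int[mu]_t (\1_(unarrived N k) (w, t))%:E)%E = tau k w.
Proof.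
move=> k0; pose A := [set t : R | 0 < t /\ (t%:E < tau k w)%E].
have AE : xsection (unarrived N k : set (T * measurableTypeR R)) w = A.
  apply/seteqP; split=> t; rewrite /xsection/= inE /unarrived/A/=.
    by move=> [t0]; rewrite lt_arrival_time ?ltW.
  by move=> [t0]; rewrite lt_arrival_time ?ltW.
have <- : mu A = tau k w.
  exact: lebesgue_measure_lt_ereal (arrival_time_ge0 k w).
rewrite -AE.
have mA : measurable (xsection (unarrived N k : set (T * measurableTypeR R)) w).
  by apply: measurable_xsection; exact: measurable_unarrived.
have := integral_indic lebesgue_measure measurableT mA.
rewrite setIT => <-.
by apply: eq_integral => t _; rewrite !indicE mem_xsection.
Qed.

End arrival.

(** * Laws of the counts and of pairs of counts *)

Lemma measure_ltn_sum d (T : measurableType d) (R : realType)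
    (P : probability T R) (A : set T) (f : T -> nat) k :
  measurable A -> measurable_fun setT f ->
  P (A `&` [set w | (f w < k)%N]) =
  (\sum_(j < k) P (A `&` f @^-1` [set nat_of_ord j]))%E.
Proof.
move=> mA mf.
have mfB B : measurable (A `&` f @^-1` B).
  by apply: measurableI => //; rewrite -[X in measurable X]setTI; exact: mf.
elim: k => [|k ih].
  by rewrite big_ord0 [X in P X](_ : _ = set0) ?measure0// -subset0 => w [].
rewrite big_ord_recr/= -ih -measureU//.
- congr (P _); rewrite -setIUr; congr (_ `&` _); apply/seteqP; split=> w /=.
    by rewrite ltnS leq_eqVlt => /orP[/eqP|]; [right|left].
  by move=> [/ltnW//|->].
- exact: (mfB [set m | (m < k)%N]).
- by rewrite -subset0 => w [[_ /= +] [_ /= E]]; rewrite E ltnn.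
Qed.

Section poisson_laws.
Context {d : measure_display} {T : measurableType d} {R : realType}.
Context {P : probability T R} {theta : R} {N : R -> {RV P >-> nat}}.
Hypothesis poissonN : poisson_process P theta N.

Let p (t : R) k := poisson_pmf (theta * t) k.

(** The preimage is split according to the countably many pairs of values of N_t and N_s. *)
Lemma measurable_increment s t : measurable_fun setT (increment N s t).
Proof.
have mf u B : measurable (N u @^-1` B).
  by rewrite -[X in measurable X]setTI; exact: measurable_funP.
move=> _ B _; rewrite setTI.
rewrite [X in measurable X](_ : _ = \bigcup_i \bigcup_j
    ([set w | B (i - j)%N] `&` (N t @^-1` [set i] `&` N s @^-1` [set j]))).
  apply: bigcup_measurable => i _; apply: bigcup_measurable => j _.
  apply: measurableI; last exact: measurableI.
  have [Bij|Bij] := pselect (B (i - j)%N).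
    by rewrite [X in measurable X](_ : _ = setT)// -subTset.
  by rewrite [X in measurable X](_ : _ = set0)// -subset0.
apply/seteqP; split=> w /=.
  by move=> Bw; exists (N t w) => //; exists (N s w).
by move=> [i _ [j _ [/= Bij [Ni Nj]]]]; rewrite /increment Ni Nj.
Qed.

Lemma increment0 t : increment N 0 t = N t.
Proof.
by apply/funext => w; rewrite /increment (poisson_process_start poissonN) subn0.
Qed.

Lemma poisson_joint_law s t j i : 0 < s -> s < t ->
  P (N s @^-1` [set j] `&` increment N s t @^-1` [set i]) =
  (p s j * p (t - s) i)%:E.
Proof.
move=> s0 st.
(* The times 0, s, t: the first of the two increments is N_s itself, since N_0 = 0. *)
pose u (m : nat) : R := if m is m'.+1 then if m' is _.+1 then t else s else 0.
have := @poisson_process_independent_increments _ _ _ _ _ _ poissonN 2 u.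
have u_lt m : (m < 2)%N -> u m < u m.+1 by case: m => [//|[|]//].
move=> /(_ (lexx _) u_lt).
pose B (m : 'I_2) : set nat := if m == ord0 then [set j] else [set i].
have inJ (m : 'I_2) : m \in finset.finset xpredT by rewrite inE.
move=> /(_ (finset.finset xpredT) B (fun _ => I)).
rewrite [X in P X](_ : _ = N s @^-1` [set j] `&` increment N s t @^-1` [set i]).
  move=> ->; rewrite (eq_bigl xpredT); last by move=> m; rewrite inJ.
  rewrite big_ord_recl big_ord1 /B/= increment0.
  have := @poisson_process_increment_law _ _ _ _ _ _ poissonN 0 s j (lexx _) s0.
  rewrite increment0 subr0 => ->.
  by rewrite (@poisson_process_increment_law _ _ _ _ _ _ poissonN) ?ltW.
apply/seteqP; split=> w /=.
  move=> H; split.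
    by have := H ord0 (inJ _); rewrite /B/= increment0.
  by have := H (lift ord0 ord0) (inJ _); rewrite /B/=.
move=> [H1 H2] m _; rewrite /B.
case: m => -[|[|//]] m2 /=; first by rewrite increment0.
exact: H2.
Qed.

Lemma poisson_law t j : 0 < t -> P (N t @^-1` [set j]) = (p t j)%:E.
Proof.
move=> t0.
have := @poisson_process_increment_law _ _ _ _ _ _ poissonN 0 t j (lexx _) t0.
by rewrite subr0 increment0.
Qed.

Lemma poisson_cdf t k : 0 < t ->
  P [set w | (N t w < k)%N] = (\sum_(j < k) p t j)%:E.
Proof.
move=> t0; rewrite -[X in P X]setTI measure_ltn_sum// -sumEFin.
by apply: eq_bigr => j _; rewrite setTI poisson_law.
Qed.

(** Split according to the value j of N_s; then N_t < n means that the increment from s to t is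
    below n - j. *)
Lemma poisson_joint_cdf s t k n : 0 < s -> s < t -> (k <= n)%N ->
  P ([set w | (N t w < n)%N] `&` [set w | (N s w < k)%N]) =
  (\sum_(j < k) p s j * \sum_(i < n - j) p (t - s) i)%:E.
Proof.
move=> s0 st kn.
have mf u B : measurable (N u @^-1` B).
  by rewrite -[X in measurable X]setTI; exact: measurable_funP.
rewrite measure_ltn_sum//; last exact: (mf t [set m | (m < n)%N]).
rewrite -sumEFin; apply: eq_bigr => j _; rewrite mulr_sumr -sumEFin.
rewrite [X in P X](_ : _ = N s @^-1` [set nat_of_ord j] `&`
    [set w | (increment N s t w < n - j)%N]).
  rewrite measure_ltn_sum//; last exact: measurable_increment.
  by apply: eq_bigr => i _; rewrite poisson_joint_law.
rewrite setIC; apply/seteqP; split=> w /= [sj];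
  have := @poisson_process_nondecreasing _ _ _ _ _ _ poissonN w _ _
    (ltW s0) (ltW st);
  by rewrite /increment sj => /ltn_sub2rE ->.
Qed.

End poisson_laws.

(** * Mixed second moments of the arrival times *)

Section arrival_moments.
Context {d : measure_display} {T : measurableType d} {R : realType}.
Context {P : probability T R} {theta : R} {N : R -> {RV P >-> nat}}.
Hypothesis theta_gt0 : 0 < theta.
Hypothesis poissonN : poisson_process P theta N.

Local Notation tau := (arrival_time N).
Local Notation mu := (@lebesgue_measure R).
Let p (t : R) k := poisson_pmf (theta * t) k.

Let p_ge0 t k : 0 <= p t k. Proof. exact: poisson_pmf_ge0. Qed.

Let measurable_p D a k :
  measurable D -> measurable_fun D (fun t : R => p (t - a) k).
Proof.
move=> mD; apply: (@measurableT_comp _ _ _ _ _ _ (@poisson_pmf R ^~ k)).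
  exact: measurable_poisson_pmf.
by apply: measurable_funM => //; exact: measurable_funB.
Qed.

Let integral_p a c k : 0 <= c ->
  (\int[mu]_(t in `]a, +oo[) (c * p (t - a) k : R)%:E)%E = (c / theta : R)%:E.
Proof.
move=> c0; under eq_integral do rewrite EFinM.
rewrite ge0_integralZl_EFin//.
- by rewrite (integral_poisson_pmf _ _ theta_gt0).
- by move=> t _; rewrite lee_fin.
- by apply/measurable_EFinP; exact: measurable_p.
Qed.

(** For s <= 0 both sides vanish. For 0 < s <= t, N_t < k already forces N_s < n. For s > t the
    joint law applies. Restrictions to disjoint intervals let the integral over s split
    afterwards. *)
Let expectation_unarrived2 n k s (t : R) :
  (0 < k)%N -> (k <= n)%N -> 0 < t ->
  (\int[P]_w (\1_(unarrived N n) (w, s) * \1_(unarrived N k) (w, t) : R)%:E)%E =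
  ((cst (\sum_(j < k) p t j)%:E \_ `]0%R, t]) s +
   ((fun s => \sum_(j < k) \sum_(i < n - j) (p t j * p (s - t) i : R)%:E)
     \_ `]t, +oo[) s)%E.
Proof.
move=> k0 kn t0.
have mf u m : measurable (N u @^-1` [set i | (i < m)%N]).
  by rewrite -[X in measurable X]setTI; exact: measurable_funP.
have [s0|s0] := leP s 0.
  rewrite !patchE !memNset ?adde0 /=; last 2 first.
  - by rewrite in_itv/= andbT ltNge (le_trans s0 (ltW t0)).
  - by rewrite in_itv/= ltNge s0.
  apply: integral0_eq => w _; rewrite indicE memNset ?mul0r//.
  by rewrite /unarrived/= ltNge s0 => -[].
transitivity (P ([set w | (N s w < n)%N] `&` [set w | (N t w < k)%N])).
  rewrite -[X in P X]setIT -integral_indic//; last first.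
    exact: measurableI (mf _ _) (mf _ _).
  apply: eq_integral => w _; rewrite !indicE -natrM mulnb; congr (_ %:R)%:E.
  congr nat_of_bool; apply/andP/idP; rewrite !inE /unarrived/=.
    by move=> [[_ ?] [_ ?]].
  by move=> [? ?].
have [st|ts] := leP s t.
  rewrite !patchE mem_set ?memNset/= ?in_itv/= ?s0 ?st ?adde0//; last first.
    by rewrite andbT ltNge st.
  rewrite -(poisson_cdf poissonN k t0) setIidr// => w /=.
  move=> Nk; apply: leq_ltn_trans (leq_trans Nk kn).
  exact: (@poisson_process_nondecreasing _ _ _ _ _ _ poissonN w _ _ (ltW s0)).
rewrite !patchE memNset ?mem_set/= ?in_itv/= ?ts ?add0e//; last first.
  by rewrite (leNgt s) ts andbF.
rewrite (poisson_joint_cdf poissonN)// -sumEFin; apply: eq_bigr => j _.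
by rewrite mulr_sumr -sumEFin.
Qed.

Lemma integral_expectation_unarrived2 n k (t : R) :
  (0 < k)%N -> (k <= n)%N -> 0 < t ->
  (\int[mu]_s \int[P]_w
     (\1_(unarrived N n) (w, s) * \1_(unarrived N k) (w, t) : R)%:E)%E =
  (\sum_(j < k) p t j * (t + (n - j)%N%:R / theta) : R)%:E.
Proof.
move=> k0 kn t0.
under eq_integral do rewrite (expectation_unarrived2 _ k0 kn t0).
have f0 s : (0 <= \sum_(j < k) \sum_(i < n - j) (p t j * p (s - t) i : R)%:E)%E.
  by apply: sume_ge0 => j _; apply: sume_ge0 => i _; rewrite lee_fin mulr_ge0.
have mf j i : measurable_fun `]t, +oo[ (fun s => (p t j * p (s - t) i : R)%:E).
  by apply/measurable_EFinP; apply: measurable_funM => //; exact: measurable_p.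
rewrite ge0_integralD//; first last.
- apply/(measurable_restrictT _ _).1 => //; apply: emeasurable_sum => j.
  by apply: emeasurable_sum => i; exact: mf.
- by move=> s _; apply: erestrict_ge0 => ? _; exact: f0.
- by apply/(measurable_restrictT _ _).1.
- move=> s _; apply: erestrict_ge0 => ? _; rewrite lee_fin/=.
  exact: sumr_ge0.
rewrite -!integral_mkcond integral_cst//.
have mu0t : mu `]0%R, t]%classic = t%:E.
  by rewrite lebesgue_measure_itv/= lte_fin t0 oppr0 adde0.
rewrite [X in (_ * X)%E]mu0t.
rewrite ge0_integral_sum//; last 2 first.
- by move=> j; apply: emeasurable_sum => i; exact: mf.
- by move=> j s _; apply: sume_ge0 => i _; rewrite lee_fin mulr_ge0.
transitivity ((\sum_(j < k) p t j) * t +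
    \sum_(j < k) (n - j)%N%:R * (p t j / theta) : R)%:E; last first.
  rewrite mulr_suml -big_split/=; congr _%:E.
  by apply: eq_bigr => j _; ring.
rewrite EFinD; congr (_ + _)%E; rewrite -sumEFin; apply: eq_bigr => j _.
rewrite ge0_integral_sum//; last 2 first.
- by move=> i; exact: mf.
- by move=> i s _; rewrite lee_fin mulr_ge0.
under eq_bigr => i _ do rewrite integral_p//.
by rewrite sumEFin sumr_const card_ord mulr_natl.
Qed.

(** Tonelli is used twice: first with [tau k] written as an integral over t, then, for each fixed t,
    with [tau n] written as an integral over s. *)
Lemma expectation_arrival_time2 n k : (0 < k)%N -> (k <= n)%N ->
  (\int[P]_w (tau n w * tau k w))%E = ((k * n.+1)%N%:R / theta ^+ 2 : R)%:E.
Proof.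
move=> k0 kn; have n0 := leq_trans k0 kn.
have mU m : (0 < m)%N ->
    measurable_fun setT (\1_(unarrived N m) : T * measurableTypeR R -> R).
  by move=> m0; apply: measurable_indic; exact: (measurable_unarrived poissonN).
have mUw m w : (0 < m)%N ->
    measurable_fun setT (fun t : R => \1_(unarrived N m) (w, t) : R).
  by move=> m0; exact: (measurable_fun_pair2 w (mU m m0)).
have mUt m (t : R) : (0 < m)%N ->
    measurable_fun setT (fun w : T => \1_(unarrived N m) (w, t) : R).
  by move=> m0; exact: (measurable_fun_pair1 t (mU m m0)).
transitivity
  (\int[P]_w \int[mu]_t (tau n w * (\1_(unarrived N k) (w, t))%:E))%E.
  apply: eq_integral => w _.
  rewrite ge0_integralZl ?(integral_unarrived poissonN)//.
  - by apply/measurable_EFinP; exact: mUw.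
  - exact: arrival_time_ge0.
rewrite (@fubini_tonelli _ _ _ _ _ P mu
  (fun z => (tau n z.1 * (\1_(unarrived N k) z)%:E)%E))/=; last 2 first.
- apply: emeasurable_funM.
    by apply: measurableT_comp => //; exact: (measurable_arrival_time poissonN).
  by apply/measurable_EFinP; exact: mU.
- by move=> z; rewrite mule_ge0 ?arrival_time_ge0// lee_fin.
transitivity (\int[mu]_t
    ((fun t => (\sum_(j < k) p t j * (t + (n - j)%N%:R / theta) : R)%:E)
      \_ `]0%R, +oo[ t))%E.
  apply: eq_integral => t _; rewrite patchE.
  have [t0|t0] := leP t 0.
    rewrite memNset/= ?in_itv/= ?ltNge ?t0//.
    apply: integral0_eq => w _; rewrite indicE memNset ?mule0//.
    by rewrite /unarrived/= ltNge t0 => -[].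
  rewrite mem_set/= ?in_itv/= ?t0// -(@integral_expectation_unarrived2 n k t)//.
  rewrite -(@fubini_tonelli _ _ _ _ _ P mu
    (fun z => (\1_(unarrived N n) z * \1_(unarrived N k) (z.1, t))%:E))/=; last 2 first.
  - apply/measurable_EFinP; apply: measurable_funM; first exact: mU.
    exact: (measurableT_comp (mUt k t k0) measurable_fst).
  - by move=> z; rewrite lee_fin mulr_ge0.
  apply: eq_integral => w _.
  under [RHS]eq_integral do rewrite EFinM.
  rewrite ge0_integralZr ?(integral_unarrived poissonN)//.
  by apply/measurable_EFinP; exact: mUw.
rewrite -integral_mkcond.
(* The factor t is absorbed by t P(N_t = j) = (j + 1) / theta * P(N_t = j + 1). Writing [t - 0]
   matches [integral_p] at a = 0. *)
transitivity (\int[mu]_(t in `]0%R, +oo[) (\sum_(j < k)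
    ((j.+1%:R / theta * p (t - 0) j.+1 : R)%:E +
     ((n - j)%N%:R / theta * p (t - 0) j : R)%:E)))%E.
  apply: eq_integral => t; rewrite inE/= in_itv/= andbT => t0.
  rewrite -sumEFin; apply: eq_bigr => j _; rewrite -EFinD subr0; congr _%:E.
  rewrite /p /poisson_pmf mulr_gt0// factS natrM exprS.
  by field; rewrite pnatr_eq0 -lt0n fact_gt0 gt_eqF//= addrC natr1.
rewrite ge0_integral_sum//; last 2 first.
- move=> j; apply: emeasurable_funD; apply/measurable_EFinP;
    by apply: measurable_funM => //; exact: measurable_p.
- by move=> j t _; rewrite adde_ge0// lee_fin mulr_ge0// divr_ge0// ltW.
(* Each j contributes ((j + 1) + (n - j)) / theta^2, which does not depend on j. *)
pose c : R := n.+1%:R / theta ^+ 2.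
transitivity (\sum_(j < k) c)%:E; last first.
  rewrite sumr_const card_ord natrM /c; congr _%:E; ring.
rewrite -sumEFin.
apply: eq_bigr => j _; rewrite ge0_integralD//; first last.
  - by apply/measurable_EFinP; apply: measurable_funM => //; exact: measurable_p.
  - by move=> t _; rewrite lee_fin mulr_ge0// divr_ge0// ltW.
  - by apply/measurable_EFinP; apply: measurable_funM => //; exact: measurable_p.
  - by move=> t _; rewrite lee_fin mulr_ge0// divr_ge0// ltW.
  rewrite !integral_p ?divr_ge0 ?(ltW theta_gt0)// -EFinD; congr _%:E.
  rewrite /c; have -> : n.+1%:R = j.+1%:R + (n - j)%N%:R :> R.
    by rewrite -natrD addSn subnKC// (leq_trans _ kn)// ltnW.
  by field; rewrite gt_eqF.
Qed.

End arrival_moments.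

(** * Passage time and area through arrival times *)

(** With m = N_t and a = n - 1, this counts the levels 1 <= k < n not yet reached at time t. *)
Lemma sum_leq_ord (m a : nat) : (\sum_(i < a) (m <= i) = a - m)%N.
Proof.
elim: a => [|a ih]; first by rewrite big_ord0.
rewrite big_ord_recr/= ih; case: leqP => ma; first by rewrite subSn ?addn1.
by rewrite addn0 (eqP (ltnW ma)) (eqP ma).
Qed.

Section area.
Context {d : measure_display} {T : measurableType d} {R : realType}.
Context {P : probability T R} {theta : R} {N : R -> {RV P >-> nat}}.
Hypothesis poissonN : poisson_process P theta N.
Variables (x : R) (n : nat).
Hypothesis n_gt0 : (0 < n)%N.
(** Says that n is the ceiling of x, so integer and non-integer x are treated together. *)
Hypothesis xn : forall m : nat, (x <= m%:R) = (n <= m)%N.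

Local Notation tau := (arrival_time N).
Local Notation mu := (@lebesgue_measure R).

Lemma passage_timeE w : passage_time x N w = tau n w.
Proof.
congr (ereal_inf (_ @` _)); apply/seteqP; split=> t /= [t0].
  by rewrite /level subr_le0 xn.
by rewrite /level subr_le0 xn.
Qed.

(** The height of X while N = n - 1, the last value before passage. *)
Let c : R := x - n%:R + 1.

Let nE : n%:R = n.-1%:R + 1 :> R. Proof. by rewrite natr1 prednK. Qed.

Lemma passage_area_coef_ge0 : 0 <= c.
Proof.
have := xn n.-1; rewrite -[X in (X <= _)%N](prednK n_gt0) ltnn => /negbT.
by rewrite -ltNge /c nE; lra.
Qed.

(** The path of X before passage, extended by 0 to all other times, as a combination of
    indicators. *)
Let g w (t : R) : \bar R :=
  (c%:E * (\1_(unarrived N n) (w, t))%:E +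
   \sum_(i < n.-1) (\1_(unarrived N i.+1) (w, t))%:E)%E.

Let measurable_un k w : (0 < k)%N ->
  measurable_fun setT (fun t : R => (\1_(unarrived N k) (w, t))%:E : \bar R).
Proof.
move=> k0; apply/measurable_EFinP.
have mU : measurable_fun setT (\1_(unarrived N k) : T * measurableTypeR R -> R).
  by apply: measurable_indic; exact: (measurable_unarrived poissonN).
exact: (measurable_fun_pair2 w mU).
Qed.

Let measurable_g w : measurable_fun setT (g w).
Proof.
apply: emeasurable_funD; last first.
  by apply: emeasurable_sum => i; exact: measurable_un.
by apply: measurable_funeM; exact: measurable_un.
Qed.

Let levelE w t : 0 < t -> (t%:E < tau n w)%E -> (level x N t w)%:E = g w t.
Proof.
move=> t0; rewrite (lt_arrival_time poissonN) ?(ltW t0)// => Nn.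
rewrite /g indicE mem_set/= ?mule1; last by [].
under eq_bigr => i _.
  have -> : \1_(unarrived N i.+1) (w, t) = (N t w <= i)%N%:R :> R.
    rewrite indicE; congr (_ %:R); congr nat_of_bool.
    by apply/idP/idP; rewrite inE /unarrived/= ltnS// => -[].
  over.
rewrite sumEFin -EFinD /level -natr_sum sum_leq_ord; congr _%:E.
have Nn1 : (N t w <= n.-1)%N by rewrite -ltnS prednK.
by rewrite natrB// /c nE; ring.
Qed.

Let D0 w := [set t : R | 0 < t /\ (t%:E < tau n w)%E].

Let gD0 w t : ~ D0 w t -> g w t = 0%E.
Proof.
move=> D0t; rewrite /g indicE memNset ?mule0 ?add0e; last first.
  move=> [t0 /= Nk]; apply: D0t; split=> //.
  by rewrite (lt_arrival_time poissonN) ?(ltW t0).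
rewrite big1// => i _; rewrite indicE memNset// => -[t0 /= Nk].
apply: D0t; split=> //; rewrite (lt_arrival_time poissonN) ?(ltW t0)//.
by rewrite (leq_trans Nk)// -[leqRHS](prednK n_gt0) ltnS ltnW.
Qed.

(** The end points 0 and, when finite, [tau n w] are null sets. Dropping them leaves the times at
    which the level equals [g w]. *)
Let level_D w :
  passage_area x N w = (\int[mu]_(t in D0 w) (level x N t w)%:E)%E.
Proof.
rewrite /passage_area passage_timeE.
have mlev D : D `<=` D0 w -> measurable_fun D (fun t => (level x N t w)%:E).
  move=> DD0; apply: (@eq_measurable_fun _ _ _ _ _ (g w)).
    by move=> t; rewrite inE => /DD0[t0 tn]; rewrite levelE.
  exact: measurable_funTS.
have : (0 <= tau n w)%E by exact: arrival_time_ge0.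
case E : (tau n w) => [r| |]; rewrite ?leNye// => r0.
- have D0E : D0 w = `]0, r[%classic.
    by apply/seteqP; split=> t; rewrite /D0/= E lte_fin in_itv/= => /andP.
  rewrite [X in integral _ X](_ : _ = `[0, r]%classic); last first.
    by apply/seteqP; split=> t /=; rewrite lee_fin in_itv/= => /andP.
  by rewrite D0E integral_itv_bndoo//; apply: mlev; rewrite D0E.
- have D0E : D0 w = `]0, +oo[%classic.
    by apply/seteqP; split=> t; rewrite /D0/= E ltry in_itv/= andbT// => -[].
  rewrite [X in integral _ X](_ : _ = `[0, +oo[%classic); last first.
    by apply/seteqP; split=> t /=; rewrite leey in_itv/= andbT// => -[].
  by rewrite D0E integral_itv_obnd_cbnd//; apply: mlev; rewrite D0E.
Qed.

Lemma passage_areaE w : passage_area x N w =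
  (c%:E * tau n w + \sum_(i < n.-1) tau i.+1 w)%E.
Proof.
have un0 k t : (0 <= (\1_(unarrived N k) (w, t))%:E :> \bar R)%E.
  by rewrite lee_fin.
rewrite level_D integral_mkcond.
transitivity (\int[mu]_t g w t)%E.
  apply: eq_integral => t _; rewrite patchE; case: ifPn => [|/negP].
    by rewrite inE => -[t0 tn]; exact: levelE.
  by rewrite inE => /gD0.
rewrite ge0_integralD//; first last.
- by apply: emeasurable_sum => i; exact: measurable_un.
- by move=> t _; exact: sume_ge0.
- by apply: measurable_funeM; exact: measurable_un.
- by move=> t _; rewrite mule_ge0// lee_fin passage_area_coef_ge0.
rewrite ge0_integralZl_EFin//; last 2 first.
- exact: measurable_un.
- exact: passage_area_coef_ge0.
rewrite (integral_unarrived poissonN)//; congr (_ + _)%E.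
rewrite ge0_integral_sum//; last by move=> i; exact: measurable_un.
by apply: eq_bigr => i _; rewrite (integral_unarrived poissonN).
Qed.

Hypothesis theta_gt0 : 0 < theta.

Lemma expectation_passage_time_area :
  (\int[P]_w (passage_time x N w * passage_area x N w))%E =
  (n%:R * n.+1%:R * (2 * x - n%:R + 1) / (2 * theta ^+ 2) : R)%:E.
Proof.
have tau0 k w : (0 <= tau k w)%E by exact: arrival_time_ge0.
have mtau k : (0 < k)%N -> measurable_fun setT (tau k).
  by move=> k0; exact: (measurable_arrival_time poissonN).
have mtt k : (0 < k)%N -> measurable_fun setT (fun w => tau n w * tau k w)%E.
  by move=> k0; apply: emeasurable_funM; exact: mtau.
transitivity (\int[P]_w (c%:E * (tau n w * tau n w) +
    \sum_(i < n.-1) tau n w * tau i.+1 w))%E.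
  apply: eq_integral => w _; rewrite passage_timeE passage_areaE.
  (* [tau n w] may be infinite, so distributivity rests on the nonnegativity of both summands. *)
  rewrite ge0_muleDr; last 2 first.
  - by rewrite mule_ge0// lee_fin passage_area_coef_ge0.
  - exact: sume_ge0.
  by rewrite muleCA ge0_sume_distrr.
rewrite ge0_integralD//; first last.
- by apply: emeasurable_sum => i; exact: mtt.
- by move=> w _; apply: sume_ge0 => i _; exact: mule_ge0.
- by apply: measurable_funeM; exact: mtt.
- by move=> w _; rewrite mule_ge0 ?mule_ge0// lee_fin passage_area_coef_ge0.
rewrite ge0_integralZl_EFin//; last 3 first.
- by move=> w _; exact: mule_ge0.
- exact: mtt.
- exact: passage_area_coef_ge0.
rewrite (expectation_arrival_time2 theta_gt0 poissonN)//.
rewrite ge0_integral_sum//; last 2 first.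
- by move=> i; exact: mtt.
- by move=> i w _; exact: mule_ge0.
pose s (i : nat) : R := (i.+1 * n.+1)%N%:R / theta ^+ 2.
pose S : R := \sum_(i < n.-1) s i.
transitivity (c * ((n * n.+1)%N%:R / theta ^+ 2) + S : R)%:E.
  rewrite [RHS]EFinD -sumEFin.
  congr (_ + _)%E; apply: eq_bigr => i _.
  rewrite (expectation_arrival_time2 theta_gt0 poissonN)//.
  by rewrite (leq_trans (ltn_ord i))// leq_pred.
(* The sum of the integers 1 to n - 1, by induction on [n.-1] with the factor n + 1 kept fixed. *)
have -> : S = n.-1%:R * n%:R / 2 * n.+1%:R / theta ^+ 2.
  rewrite nE /S; elim: n.-1 => [|m ih]; first by rewrite big_ord0 !mul0r.
  rewrite big_ord_recr/= ih /s natrM -!natr1.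
  by field; rewrite gt_eqF.
congr _%:E; rewrite /c natrM -natr1 nE.
by field; rewrite gt_eqF.
Qed.

End area.

Theorem mainTheorem2 (d : measure_display) (T : measurableType d)
    (R : realType) (P : probability T R) (theta : R) (theta_gt0 : 0 < theta)
    (N : R -> {RV P >-> nat}) (poissonN : poisson_process P theta N)
    (x : R) (x_gt0 : 0 < x) :
  let fl : R := (Num.floor x)%:~R in
  (\int[P]_w (passage_time x N w * passage_area x N w))%E =
  (if x \is a Num.int then x * (x + 1) ^+ 2 / (2 * theta ^+ 2)
   else (fl + 1) * (fl + 2) * (2 * x - fl) / (2 * theta ^+ 2))%:E.
Proof.
move=> fl.
(* The ceiling is nonnegative as x > 0, so the absolute value only turns it into a natural
   number. *)
pose n := `|Num.ceil x|%N.
have nE : n%:R = (Num.ceil x)%:~R :> R.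
  by rewrite /n pmulrn gez0_abs// ceil_ge0// (lt_trans _ x_gt0)// ltrN10.
have xn (m : nat) : (x <= m%:R) = (n <= m)%N.
  by rewrite -(ler_nat R) nE pmulrn ler_int ceil_le_int.
have n_gt0 : (0 < n)%N by rewrite ltnNge -xn -ltNge.
rewrite (expectation_passage_time_area poissonN n_gt0 xn theta_gt0) -natr1.
(* The common formula n (n + 1) (2x - n + 1) is evaluated at n = x for an integer, and at n = [x] +
   1 otherwise. *)
congr _%:E; case: ifPn => xint.
  have -> : n%:R = x by rewrite nE; apply/eqP; rewrite -intrEceil.
  by rewrite expr2; congr (_ / _); ring.
have -> : n%:R = fl + 1.
  by rewrite nE ceil_floor xint intrD.
by congr (_ / _); ring.
Qed.
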